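(* Let $H$ be a separable, infinite dimensional real Hilbert space and let $C\subseteq H$ be a closed, strictly convex, somewhat bounded set. Then there exists a residual set $\mathcal{R}\subseteq\mathcal{N}(C)$ such that every $f\in\mathcal{R}$ has a unique fixed point.
   Context: For a subset $C$ of a Hilbert space $H$ with norm $\|\cdot\|$, $\mathcal{N}(C)$ denotes the set of all nonexpansive mappings $f\colon C\to C$, i.e. mappings with $\|f(x)-f(y)\|\le\|x-y\|$ for all $x,y\in C$. It is endowed with the topology of pointwise convergence, i.e. the coarsest topology containing all sets $\{g\in\mathcal{N}(C): \|g(x)-f(x)\|<\varepsilon\}$ with $f\in\mathcal{N}(C)$, $x\in C$, $\varepsilon>0$. A nonempty, non-singleton convex set $C$ in an infinite dimensional Hilbert space $H$ is called somewhat bounded if there are $x_0\in C$, a finite dimensional subspace $F\subseteq H$ and $\alpha>0$ such that $\alpha B_F\subseteq C-x_0$ and $F^\perp\cap(C-x_0)$ is bounded. Here $B_F$ is the closed unit ball of $F$ and $F^\perp$ the orthogonal complement of $F$ in $H$. A closed convex set $C\subseteq H$ is strictly convex if its boundary $\partial C$ (in $H$) contains no nontrivial convex subset, i.e. no line segment $[x,y]$ with $x\neq y$. A subset of a topological space is meager if it is a countable union of nowhere dense sets, and residual if its complement is meager. *)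

(* Defs.v *)
From HB Require Import structures.
From mathcomp Require Import all_boot all_order all_algebra.
From mathcomp Require Import all_classical all_reals all_analysis.
From mathcomp Require Import sesquilinear.

Set Implicit Arguments.
Unset Strict Implicit.
Unset Printing Implicit Defensive.

Import Order.TTheory GRing.Theory Num.Theory.
Import numFieldNormedType.Exports.

Local Open Scope classical_set_scope.
Local Open Scope ring_scope.

Section topology.
Context {T : topologicalType}.

Definition separable_space : Prop :=
  exists2 S : set T, countable S & dense S.

Definition boundary (A : set T) : set T := closure A `\` interior A.

Definition nowhere_dense (A : set T) : Prop := interior (closure A) = set0.

Definition meager (A : set T) : Prop :=
  exists2 F : (set T)^nat,
    (forall n, nowhere_dense (F n)) & A = \bigcup_n F n.

Definition residual (A : set T) : Prop := meager (~` A).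

End topology.

Arguments separable_space T : clear implicits.

Section vector_space.
Context {R : realType} {V : lmodType R}.

Definition finite_span (n : nat) (e : 'I_n -> V) : set V :=
  [set x | exists a : 'I_n -> R, x = \sum_(i < n) a i *: e i].

Definition finite_dim_subspace (F : set V) : Prop :=
  exists (n : nat) (e : 'I_n -> V), F = finite_span e.

Definition infinite_dim_space : Prop := ~ finite_dim_subspace [set: V].

Definition segment (x y : V) : set V :=
  [set (conv t (x : convex_lmodType V) (y : convex_lmodType V) : V)
     | t in [set: {i01 R}]].

Definition orthogonal_complement (dot : {dot V for idfun}) (F : set V)
    : set V :=
  [set x | forall y, F y -> dot x y = 0].

End vector_space.

Arguments infinite_dim_space {R} V.

(* The topology and completeness of a [completeNormedModType] come from its
   norm, so this makes it a real Hilbert space with inner product [dot]. *)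
Definition hilbert_norm (R : realType) (H : completeNormedModType R)
    (dot : {dot H for idfun}) : Prop :=
  forall x : H, `|x| = Num.sqrt (dot x x).

Section convex_sets.
Context {R : realType} {H : completeNormedModType R}.

Definition unit_ball_in (F : set H) : set H := [set x | F x /\ `|x| <= 1].

Definition somewhat_bounded (dot : {dot H for idfun}) (C : set H) : Prop :=
  [/\ C !=set0, ~ (exists x, C = [set x]), convex_set C &
    exists (x0 : H) (F : set H) (alpha : R),
      [/\ C x0, finite_dim_subspace F, 0 < alpha,
          [set alpha *: x | x in unit_ball_in F]
            `<=` [set x - x0 | x in C] &
          bounded_set (orthogonal_complement dot F
                       `&` [set x - x0 | x in C])]].

Definition strictly_convex (C : set H) : Prop :=
  [/\ closed C, convex_set C &
    forall x y : H, x != y -> ~ (segment x y `<=` boundary C)].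

(* As a type, [nonexpansive_maps C] carries the subspace topology of
   [{ptws C -> C}], i.e. the topology of pointwise convergence. *)
Definition nonexpansive_maps (C : set H) : set {ptws C -> C} :=
  [set f : {ptws C -> C} |
    forall x y : C,
      `|set_val (f x) - set_val (f y)| <= `|set_val x - set_val y|].

End convex_sets.

Arguments nonexpansive_maps {R H} C.

(* Main.v *)
Require Import Defs.
From mathcomp Require Import all_boot all_order all_algebra.
From mathcomp Require Import all_classical all_reals all_analysis.
From mathcomp Require Import sesquilinear.
From mathcomp Require Import ring lra.

(** Each single value of a nonexpansive self-map [g] of [C] constrains its
    fixed points: for each [z] in [C], they lie in the half-space
    ['[g z - z, x - z] >= 0] ([fixed_point_halfspace]). The proof controls the
    fixed points of all maps in a basic open set, which prescribes only
    finitely many values up to small errors.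

    Existence holds on a dense open set. The points [x] with
    [g x - x0 = a (x - x0)], [a > 1], converge to a fixed point as [a] tends to
    1, provided that they stay bounded ([nonexpansive_fixed_point]). By
    somewhat boundedness, finitely many linear functionals control the norm on
    [C] ([somewhat_bounded_coercive]). Any map can be changed, away from
    finitely many points, into one with bounded range, and for maps with
    bounded values at finitely many well chosen points the eigenpoints with
    [a >= 1] stay in a fixed ball ([localized_eigenpoints],
    [generic_localization]).

    Uniqueness uses strict convexity and infinite dimension. Fix a vector [d]
    and a map [f] with a fixed point [q], and let a finite set of points be
    given. From [q], walk in a direction orthogonal to all these points and
    their images until [C] is left. Close to the exit point there are a support
    point [p] of [C] and a point [z] in the interior, and [f] can be perturbed,
    hardly changing its values at the given points, into a map that moves [z]
    in the direction of the outer normal at [p] ([shear_perturbation]). The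
    half-space at [z] then cuts off from [C] a shallow slice at [p]. By strict
    convexity, [p] is the only maximizer of the normal on [C], so that shallow
    slices are thin in the direction [d] ([thin_slice]); the nested set
    argument behind this replaces weak compactness. Hence for each [d], the
    maps all of whose fixed points satisfy ['[d, x - y] <= 1] contain a dense
    open set ([generic_thin]). Letting [d] range over a countable dense set of
    [H] leaves at most one fixed point ([separates_points]). *)

Set Implicit Arguments.
Unset Strict Implicit.
Unset Printing Implicit Defensive.

Import Order.TTheory GRing.Theory Num.Theory.
Import numFieldNormedType.Exports.

Local Open Scope classical_set_scope.
Local Open Scope ring_scope.

(** * Inner products, half-spaces and balls *)

Section inner_product.
Context {R : realType} {H : completeNormedModType R}.
Context {dot : {dot H for idfun}} (dot_norm : hilbert_norm dot).

Implicit Types (x y z u v w : H) (a b c t : R).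

Local Notation "''[' u , v ]" := (dot u v) : ring_scope.

Lemma dotC u v : '[u, v] = '[v, u].
Proof. by rewrite hermC expr0 mul1r. Qed.

Lemma dotDl u v w : '[u + v, w] = '[u, w] + '[v, w].
Proof. exact: linearDl. Qed.

Lemma dotDr u v w : '[w, u + v] = '[w, u] + '[w, v].
Proof. exact: linearDr. Qed.

Lemma dotNl u w : '[- u, w] = - '[u, w].
Proof. exact: linearNl. Qed.

Lemma dotNr u w : '[w, - u] = - '[w, u].
Proof. exact: linearNr. Qed.

Lemma dotZl a u w : '[a *: u, w] = a * '[u, w].
Proof. exact: linearZl_LR. Qed.

Lemma dotZr a u w : '[w, a *: u] = a * '[w, u].
Proof. exact: linearZr_LR. Qed.

Lemma dot0l w : '[0, w] = 0.
Proof. exact: linear0l. Qed.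

Lemma dot0r w : '[w, 0] = 0.
Proof. exact: linear0r. Qed.

Lemma dot_ge0 u : 0 <= '[u, u].
Proof.
by have [->|/neq0_dnorm_gt0/ltW//] := eqVneq u 0; rewrite dot0l.
Qed.

Lemma normsq u : `|u| ^+ 2 = '[u, u].
Proof. by rewrite dot_norm sqr_sqrtr// dot_ge0. Qed.

End inner_product.

(** Expands an inner product of linear combinations; what remains is linear
    arithmetic in the inner products of the atoms. *)
Ltac expand_dot :=
  rewrite ?(dotDl, dotDr, dotNl, dotNr, dotZl, dotZr, dot0l, dot0r).

Section hilbert.
Context {R : realType} {H : completeNormedModType R}.
Context {dot : {dot H for idfun}} (dot_norm : hilbert_norm dot).

Implicit Types (x y z u v w : H) (a b c t : R).

Local Notation "''[' u , v ]" := (dot u v) : ring_scope.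

Let normsq := normsq dot_norm.

(** The Cauchy-Schwarz inequality, from the positivity of the squared norm of
    [`|v| *: u - `|u| *: v]. *)
Lemma dot_le u v : '[u, v] <= `|u| * `|v|.
Proof.
have [->|u0] := eqVneq u 0; first by rewrite dot0l normr0 mul0r.
have [->|v0] := eqVneq v 0; first by rewrite dot0r normr0 mulr0.
have nu : 0 < `|u| by rewrite normr_gt0.
have nv : 0 < `|v| by rewrite normr_gt0.
have := dot_ge0 (dot := dot) (`|v| *: u - `|u| *: v).
expand_dot; rewrite -!normsq (dotC v u) => h.
have {}h : 0 <= (`|u| * `|v|) * (`|u| * `|v| - '[u, v]) by lra.
by move: h; rewrite pmulr_rge0 ?mulr_gt0// subr_ge0.
Qed.

Lemma dot_ge u v : - (`|u| * `|v|) <= '[u, v].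
Proof. by have := dot_le (- u) v; rewrite normrN dotNl => ?; lra. Qed.

Lemma normsqB x y : `|x - y| ^+ 2 = `|x| ^+ 2 - 2 * '[x, y] + `|y| ^+ 2.
Proof. by rewrite !normsq; expand_dot; rewrite (dotC y x); ring. Qed.

Lemma normsqD x y : `|x + y| ^+ 2 = `|x| ^+ 2 + 2 * '[x, y] + `|y| ^+ 2.
Proof. by rewrite !normsq; expand_dot; rewrite (dotC y x); ring. Qed.

Lemma continuous_dot v : continuous (dot v).
Proof.
move=> x; apply/cvgrPdist_lt => e e0.
have v0 : 0 < `|v| + 1 by rewrite ltr_wpDl.
near=> y.
have xy : `|x - y| < e / (`|v| + 1).
  near: y; apply: (cvgr_dist_lt (fun y : H => y)); first exact: cvg_id.
  by rewrite divr_gt0.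
rewrite ltr_pdivlMr// in xy.
have dE : '[v, x] - '[v, y] = '[v, x - y] by expand_dot.
rewrite dE ltr_norml.
have := dot_le v (x - y); have := dot_ge v (x - y).
have := normr_ge0 (x - y); have := normr_ge0 v => ? ? ? ?.
apply/andP; split; lra.
Unshelve. all: by end_near. Qed.

Lemma closed_halfspace v c : closed [set x | c <= '[v, x]].
Proof.
apply: (@closed_comp _ _ (dot v : H -> R) [set r | c <= r]).
  by move=> x _; apply: continuous_dot.
exact: closed_ge.
Qed.

Lemma closed_normball w c : closed [set x | `|x - w| <= c].
Proof.
apply: (@closed_comp _ _ (fun x : H => `|x - w| : R) [set r | r <= c]).
  move=> x _; apply: (@continuous_comp _ _ _ (fun x => x - w) (@Num.norm _ _)).
    by apply: cvgB; [exact: cvg_id|exact: cvg_cst].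
  exact: norm_continuous.
exact: closed_le.
Qed.

Lemma convex_setP (A : set H) :
  convex_set A <->
  forall x y t, 0 <= t -> t <= 1 -> A x -> A y -> A (t *: x + (1 - t) *: y).
Proof.
split=> [cA x y t t0 t1 Ax Ay|cA x y l].
  have := cA x y (Itv01 t0 t1).
  by rewrite !inE => /(_ Ax Ay).
by rewrite !inE => Ax Ay; apply: cA.
Qed.

Lemma convex_halfspace v c : convex_set ([set x | c <= '[v, x]] : set H).
Proof.
apply/convex_setP => x y t t0 t1 /= cx cy; expand_dot.
have : 0 <= t * ('[v, x] - c) by rewrite mulr_ge0// subr_ge0.
have : 0 <= (1 - t) * ('[v, y] - c) by rewrite mulr_ge0// subr_ge0.
lra.
Qed.

Lemma convex_normball w c : convex_set ([set x | `|x - w| <= c] : set H).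
Proof.
apply/convex_setP => x y t t0 t1 /= xc yc.
have -> : t *: x + (1 - t) *: y - w = t *: (x - w) + (1 - t) *: (y - w).
  rewrite !scalerBr addrACA -opprD -scalerDl.
  by rewrite (_ : t + (1 - t) = 1) ?scale1r//; ring.
apply: (le_trans (ler_normD _ _)); rewrite !normrZ (ger0_norm t0).
rewrite (@ger0_norm _ (1 - t)) ?subr_ge0//.
have : 0 <= t * (c - `|x - w|) by rewrite mulr_ge0// subr_ge0.
have : 0 <= (1 - t) * (c - `|y - w|) by rewrite mulr_ge0// subr_ge0.
lra.
Qed.

Lemma convex_setI (A B : set H) :
  convex_set A -> convex_set B -> convex_set (A `&` B).
Proof.
move=> /convex_setP cA /convex_setP cB; apply/convex_setP.
by move=> x y t t0 t1 [Ax Bx] [Ay By]; split; [exact: cA|exact: cB].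
Qed.

(** The form in which completeness is used throughout: Hilbert space estimates
    bound squared distances. *)
Lemma cvg_of_sqdist (x : nat -> H) (d : nat -> R) :
  d n @[n --> \oo] --> 0 ->
  (forall n m, (n <= m)%N -> `|x m - x n| ^+ 2 <= d n) ->
  exists l : H, x n @[n --> \oo] --> l.
Proof.
move=> d0 xd; apply/cvg_ex; apply: cauchy_cvg; apply/cauchy_exP => e e0.
have e20 : 0 < e ^+ 2 by rewrite exprn_gt0.
have /cvgrPdist_lt/(_ _ e20)[N _ hN] := d0.
exists (x N), N => //= n Nn; rewrite -ball_normE /ball_ /= distrC.
have := hN N (leqnn N); rewrite sub0r normrN => dN.
have := xd _ _ Nn; have := ler_norm (d N) => ? ?.
rewrite -(@ltr_pXn2r _ 2)// ?nnegrE//; last exact: ltW.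
lra.
Qed.

End hilbert.

(** * Nested convex sets, metric projections and fixed points *)

Section projections.
Context {R : realType} {H : completeNormedModType R}.
Context {dot : {dot H for idfun}} (dot_norm : hilbert_norm dot).

Implicit Types (x y z u v w : H) (a b c t : R).

Local Notation "''[' u , v ]" := (dot u v) : ring_scope.

Let normsq := normsq dot_norm.
Let normsqB := normsqB dot_norm.
Let normsqD := normsqD dot_norm.

(** A substitute for weak compactness of bounded sets. Near-minimizers of the
    norm on the successive sets form a Cauchy sequence: by the parallelogram
    identity and convexity, their squared distances are controlled by the
    increments of the bounded monotone sequence of infima. *)
Lemma nested_closed_convex (D : nat -> set H) (M : R) :
    (forall n, closed (D n)) -> (forall n, convex_set (D n)) ->
    (forall n, D n !=set0) -> (forall n m, (n <= m)%N -> D m `<=` D n) ->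
    (forall x, D 0%N x -> `|x| <= M) ->
  exists x, forall n, D n x.
Proof.
move=> cD vD D0 subD DM.
pose S n : set R := [set `|x| ^+ 2 | x in D n].
pose I n := inf (S n).
have S0 n : S n !=set0 by have [x Dx] := D0 n; exists (`|x| ^+ 2), x.
have lbS n : has_lbound (S n).
  by exists 0 => _ [x _ <-]; rewrite exprn_ge0.
have Ile n x : D n x -> I n <= `|x| ^+ 2.
  by move=> Dx; apply: ge_inf => //; exists x.
have ndI : {homo I : n m / (n <= m)%N >-> n <= m}.
  move=> n m nm; apply: lb_le_inf => // _ [x Dx <-]; apply: Ile.
  exact: subD Dx.
have ubI : has_ubound (range I).
  exists (M ^+ 2) => _ [n _ <-]; have [x Dx] := D0 n.
  apply: (le_trans (Ile _ _ Dx)); rewrite ler_pXn2r ?nnegrE//.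
    by apply: DM; exact: subD Dx.
  by apply: le_trans (normr_ge0 x) _; apply: DM; exact: subD Dx.
have /choice[x Dx] : forall n, exists x, D n x /\ `|x| ^+ 2 < I n + n.+1%:R^-1.
  move=> n; have n0 : 0 < n.+1%:R^-1 :> R by rewrite invr_gt0.
  by have [_ [x Dx <-] ?] := inf_adherent n0 (conj (S0 n) (lbS n)); exists x.
pose L := sup (range I).
have IL n : I n <= L by apply: ub_le_sup => //; exists n.
have Icvg : I n @[n --> \oo] --> L by exact: nondecreasing_cvgn.
pose d n : R := 2 * (L - I n) + 4 * n.+1%:R^-1.
have d0 : d n @[n --> \oo] --> 0.
  have -> : 0 = 2 * (L - L) + 4 * 0 :> R by ring.
  apply: cvgD; apply: cvgM; try exact: cvg_cst; last exact: cvg_harmonic.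
  by apply: cvgB => //; exact: cvg_cst.
have [] := cvg_of_sqdist d0 (x := x).
  move=> n m nm; have [Dn xn] := Dx n; have [Dm xm] := Dx m.
  have /Ile : D n (2^-1 *: x n + (1 - 2^-1) *: x m).
    have /convex_setP := vD n; apply => //; try lra.
    exact: subD Dm.
  have -> : 1 - 2^-1 = 2^-1 :> R by field.
  rewrite -scalerDr normrZ exprMn ger0_norm; last lra.
  rewrite (normsqD (x n) (x m)) (normsqB (x m)) (dotC (x m)) => h.
  have nm1 : m.+1%:R^-1 <= n.+1%:R^-1 :> R.
    by rewrite lef_pV2 ?posrE ?ltr0Sn// ler_nat.
  have q : 2^-1 ^+ 2 = 4^-1 :> R by field.
  have := IL m; rewrite /d; rewrite q in h; move: h xn xm nm1.
  by move: (n.+1%:R^-1) (m.+1%:R^-1) => ? ? *; lra.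
move=> l xl; exists l => n.
apply: (closed_cvg (D n) (cD n) _ _ xl).
by exists n => // m nm; exact: subD (Dx m).1.
Qed.

(** The nearest point exists as a common point of [K] and shrinking balls
    around [x]; it is characterized by the variational inequality, the only
    property of projections that is used below. *)
Lemma metric_projection (K : set H) : closed K -> convex_set K -> K !=set0 ->
  exists P : H -> H, (forall x, K (P x)) /\
    forall x y, K y -> '[x - P x, y - P x] <= 0.
Proof.
move=> cK vK K0.
suff /choice[P hP] : forall x, exists p, K p /\ forall y, K y -> '[x - p, y -
  p] <= 0.
  by exists P; split=> x; [exact: (hP x).1|exact: (hP x).2].
move=> x; pose S : set R := [set `|y - x| | y in K].
have S0 : S !=set0 by have [y Ky] := K0; exists `|y - x|, y.
have lbS : has_lbound S by exists 0 => _ [y _ <-].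
have [] := @nested_closed_convex
  (fun n => K `&` [set y | `|y - x| <= inf S + n.+1%:R^-1]) (`|x| + (inf S +
    1)).
- by move=> n; apply: closedI => //; exact: closed_normball.
- by move=> n; apply: convex_setI => //; exact: convex_normball.
- move=> n; have n0 : 0 < n.+1%:R^-1 :> R by rewrite invr_gt0.
  have [_ [y Ky <-] ?] := inf_adherent n0 (conj S0 lbS).
  by exists y; split=> //; apply/ltW.
- move=> n m nm y [Ky yx]; split=> //; apply: (le_trans yx); rewrite lerD2l.
  by rewrite lef_pV2 ?posrE ?ltr0Sn// ler_nat.
- move=> y [_ /=]; rewrite invr1 => yx; have := ler_normD x (y - x).
  by rewrite addrC subrK; lra.
move=> p hp; have Kp : K p := (hp 0%N).1.
have pmin : `|p - x| <= inf S.
  apply/ler_addgt0Pr => e e0.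
  have [n] := @near_infty_natSinv_lt R (PosNum e0).
  move=> _ /(_ n) /= => /(_ (leqnn n)) ne.
  by have [_ /= h] := hp n; apply: (le_trans h); rewrite lerD2l ltW.
exists p; split=> // y Ky; rewrite leNgt; apply/negP => s0.
set s := '[_, _] in s0.
have yp : 0 < `|y - p| ^+ 2.
  rewrite exprn_gt0// normr_gt0 subr_eq0; apply/eqP => yp.
  by move: s0; rewrite /s yp subrr dot0r ltxx.
(* Moving from [p] towards [y] by this [t] would bring [p] closer to [x]. *)
pose t := Num.min 1 (s / `|y - p| ^+ 2).
have t0 : 0 < t by rewrite lt_min ltr01 divr_gt0.
have t1 : t <= 1 by rewrite ge_min lexx.
have ts : t * `|y - p| ^+ 2 <= s.
  by rewrite -ler_pdivlMr// ge_min lexx orbT.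
have Kt : K (t *: y + (1 - t) *: p).
  by move/convex_setP: vK; apply => //; exact: ltW.
have : inf S <= `|t *: y + (1 - t) *: p - x|.
  by apply: ge_inf => //; exists (t *: y + (1 - t) *: p).
move=> /(le_trans pmin).
have -> : t *: y + (1 - t) *: p - x = t *: (y - p) - (x - p).
  by rewrite scalerBr scalerBl scale1r opprB -!addrA (addrCA p) addrA.
rewrite -(@ler_pXn2r _ 2)// ?nnegrE// (normsqB (t *: _)) normrZ exprMn.
rewrite (ger0_norm (ltW t0)) dotZl dotC -/s (distrC p) => h.
have : 0 <= t * (t * `|y - p| ^+ 2 - 2 * s) by rewrite expr2 in h; lra.
by rewrite pmulr_rge0//; lra.
Qed.

Lemma projection_nonexpansive (K : set H) (P : H -> H) :
    (forall x, K (P x)) ->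
    (forall x y, K y -> '[x - P x, y - P x] <= 0) ->
  forall x y, `|P x - P y| <= `|x - y|.
Proof.
move=> KP hP x y.
have h1 := hP x (P y) (KP y); have h2 := hP y (P x) (KP x).
have : '[P x - P y, P x - P y] <= '[x - y, P x - P y].
  by move: h1 h2; expand_dot; lra.
rewrite -normsq => /le_trans/(_ (dot_le dot_norm _ _)) h.
have [->|n0] := eqVneq `|P x - P y| 0; first exact: normr_ge0.
by move: h; rewrite expr2 ler_pM2r// lt_neqAle eq_sym n0 normr_ge0.
Qed.

Lemma projection_id (K : set H) (P : H -> H) :
    (forall x y, K y -> '[x - P x, y - P x] <= 0) ->
  forall x, K x -> P x = x.
Proof.
move=> hP x Kx; have := hP x x Kx; rewrite -normsq => h.
apply/esym/eqP; rewrite -subr_eq0 -normr_eq0 -sqrf_eq0.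
by rewrite eq_le h exprn_ge0.
Qed.

(** If [g] is nonexpansive and [x0 = 0], then [g u = (1 + a) u] and
    [g v = (1 + b) v] imply the hypothesis. Monotonicity of [1 - g] then makes
    the norm of the eigenpoint grow as its eigenvalue decreases to 1, and
    bounds the distance of two eigenpoints by the growth of the squared
    norm. *)
Lemma resolvent_sqdist u v a b :
    0 < b -> b <= a ->
    `|(1 + a) *: u - (1 + b) *: v| <= `|u - v| ->
  `|v - u| ^+ 2 <= `|v| ^+ 2 - `|u| ^+ 2.
Proof.
move=> b0 ba; rewrite -(@ler_pXn2r _ 2)// ?nnegrE// !normsqB.
rewrite !normrZ !exprMn !ger0_norm; try lra.
rewrite dotZl dotZr (dotC v u) => h.
have D0 : 0 <= `|v - u| ^+ 2 by rewrite exprn_ge0.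
rewrite normsqB (dotC v) in D0.
have : 0 <= `|a *: u - b *: v| ^+ 2 by rewrite exprn_ge0.
rewrite normsqB !normrZ !exprMn !ger0_norm; try lra.
rewrite dotZl dotZr => h'.
set X := `|u| ^+ 2 in h h' D0 *; set Y := `|v| ^+ 2 in h h' D0 *.
set s := '[u, v] in h h' D0 *.
have h2 : (a + b) * (Y - 2 * s + X) <= (a - b) * (Y - X).
  by rewrite !expr2 in h h'; lra.
have [YX|YX] := leP X Y.
  have : (a + b) * (Y - 2 * s + X) <= (a + b) * (Y - X).
    apply: (le_trans h2); rewrite ler_wpM2r ?subr_ge0//; lra.
  by rewrite ler_pM2l//; lra.
have h3 : (a - b) * (Y - X) <= 0 by rewrite mulr_ge0_le0//; lra.
have h4 : Y - 2 * s + X <= 0.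
  by have := le_trans h2 h3; rewrite pmulr_rle0//; lra.
have : `|v - u| ^+ 2 <= 0 by rewrite normsqB (dotC v).
rewrite real_exprn_even_le0//= normr_eq0 subr_eq0 => /eqP vu.
by move: YX; rewrite /X /Y vu ltxx.
Qed.

Lemma contraction_fixed_point (C : set H) (T : H -> H) q :
    closed C -> C !=set0 -> (forall x, C x -> C (T x)) -> 0 <= q -> q < 1 ->
    (forall x y, C x -> C y -> `|T x - T y| <= q * `|x - y|) ->
  exists2 x, C x & x = T x.
Proof.
move=> cC C0 CT q0 q1 hT.
pose f : {fun C >-> C} := mkfun_fun CT.
apply: (@banach_fixed_point _ _ _ f) => //.
exists (NngNum q0); split=> //= -[x y] /= [Cx Cy]; exact: hT.
Qed.

(** Browder's approximation: the fixed points [x n] of the contractions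
    [t g + (1 - t) x0] are the points with [g (x n) - x0] a multiple
    [1 + 1/(n+1)] of [x n - x0]. If such points stay bounded, they converge by
    [resolvent_sqdist], and the limit is fixed; [C] itself may be unbounded. *)
Lemma nonexpansive_fixed_point (C : set H) (g : H -> H) x0 (r : R) :
    closed C -> convex_set C -> C x0 -> (forall x, C x -> C (g x)) ->
    (forall x y, C x -> C y -> `|g x - g y| <= `|x - y|) ->
    (forall x a, C x -> 1 < a -> g x - x0 = a *: (x - x0) -> `|x - x0| <= r) ->
  exists2 x, C x & g x = x.
Proof.
move=> cC vC C0 Cg gne hr.
pose al n : R := n.+1%:R^-1.
have al0 n : 0 < al n by rewrite invr_gt0.
have /choice[x hx] : forall n, exists x, C x /\ g x - x0 = (1 + al n) *: (x -
  x0).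
  move=> n; pose t := (1 + al n)^-1.
  have a1 : 0 < 1 + al n by rewrite addr_gt0.
  have t0 : 0 < t by rewrite invr_gt0.
  have t1 : t < 1 by rewrite invf_lt1// ltrDl.
  have [||x y Cx Cy|x Cx xE] := @contraction_fixed_point C
    (fun x => t *: g x + (1 - t) *: x0) t cC _ _ (ltW t0) t1.
  - by exists x0.
  - by move=> x Cx; move/convex_setP: vC; apply => //;
      [exact: ltW|exact: ltW|exact: Cg].
  - by rewrite opprD addrACA subrr addr0 -scalerBr normrZ (gtr0_norm t0)
      ler_wpM2l ?gne// ltW.
  exists x; split=> //.
  have -> : x - x0 = t *: (g x - x0).
    by rewrite {1}xE scalerBl scale1r scalerBr -addrA (addrAC x0) subrr add0r.
  by rewrite scalerA mulfV ?scale1r// gt_eqF.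
have Cx n : C (x n) := (hx n).1.
have gx n := (hx n).2.
have xr n : `|x n - x0| <= r by apply: (hr _ (1 + al n)) => //; rewrite ltrDl.
pose phi n := `|x n - x0| ^+ 2.
have alle n m : (n <= m)%N -> al m <= al n.
  by move=> nm; rewrite lef_pV2 ?posrE ?ltr0Sn// ler_nat.
have xd n m : (n <= m)%N -> `|x m - x n| ^+ 2 <= phi m - phi n.
  move=> nm; have -> : x m - x n = (x m - x0) - (x n - x0) by rewrite opprB
    addrA subrK.
  apply: (resolvent_sqdist (al0 m) (alle _ _ nm)).
  rewrite -!gx opprB addrA subrK opprB addrA subrK; exact: gne.
have ndphi : {homo phi : n m / (n <= m)%N >-> n <= m}.
  by move=> n m nm; rewrite -subr_ge0; apply: le_trans (xd _ _ nm);
    rewrite exprn_ge0.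
have ubphi : has_ubound (range phi).
  exists (r ^+ 2) => _ [n _ <-]; rewrite ler_pXn2r ?nnegrE//.
  exact: le_trans (xr 0%N).
pose L := sup (range phi).
have phiL n : phi n <= L by apply: ub_le_sup => //; exists n.
have phicvg : phi n @[n --> \oo] --> L by exact: nondecreasing_cvgn.
have [] := @cvg_of_sqdist _ _ x (fun n => L - phi n).
- by rewrite -(subrr L); apply: cvgB => //; exact: cvg_cst.
- by move=> n m nm; apply: le_trans (xd _ _ nm) _; rewrite lerD2r.
move=> l xl.
have Cl : C l.
  by apply: (closed_cvg C cC _ _ xl); apply: nearW => n; exact: Cx.
exists l => //; apply/eqP; rewrite -subr_eq0 -normr_le0.
have bnd n : `|g l - l| <= 2 * `|x n - l| + al n * r.
  have -> : g l - l = (g l - g (x n)) + (g (x n) - x n) + (x n - l).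
    by rewrite !subrKA.
  have h1 : `|g l - g (x n)| <= `|x n - l|.
    by rewrite (distrC (x n)); exact: gne.
  have h2 : `|g (x n) - x n| <= al n * r.
    have -> : g (x n) - x n = (g (x n) - x0) - (x n - x0).
      by rewrite opprB addrA subrK.
    rewrite gx scalerDl scale1r addrAC subrr add0r normrZ (gtr0_norm (al0 n)).
    by rewrite ler_wpM2l// ltW.
  have := ler_normD ((g l - g (x n)) + (g (x n) - x n)) (x n - l).
  have := ler_normD (g l - g (x n)) (g (x n) - x n); lra.
have lim0 : 2 * `|x n - l| + al n * r @[n --> \oo] --> (0 : R).
  have -> : 0 = 2 * `|l - l| + 0 * r :> R by rewrite subrr normr0; ring.
  apply: cvgD; apply: cvgM; try exact: cvg_cst; last exact: cvg_harmonic.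
  by apply: cvg_norm; apply: cvgB => //; exact: cvg_cst.
apply: (closed_cvg (fun s : R => `|g l - l| <= s) _ _ _ lim0).
  exact: closed_ge.
exact: nearW.
Qed.

End projections.

(** * Finite dimensional subspaces and coercivity *)

Section finite_frames.
Context {R : realType} {H : completeNormedModType R}.
Context {dot : {dot H for idfun}} (dot_norm : hilbert_norm dot).

Implicit Types (x y z u v w : H) (a b c t : R) (us vs e : seq H).

Local Notation "''[' u , v ]" := (dot u v) : ring_scope.

Let normsq := normsq dot_norm.

(** For an orthonormal [us], the orthogonal projection onto its span. *)
Definition frame_sum us x : H := \sum_(u <- us) '[u, x] *: u.

Lemma dot_frame_sum us x y : '[frame_sum us x, y] = '[x, frame_sum us y].
Proof.
rewrite /frame_sum; elim: us => [|u us IH];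
  first by rewrite !big_nil dot0l dot0r.
by rewrite !big_cons; expand_dot; rewrite IH (dotC x u); ring.
Qed.

Lemma frame_sumD us x y : frame_sum us (x + y) = frame_sum us x + frame_sum us
  y.
Proof.
by rewrite /frame_sum -big_split /=; apply: eq_bigr => u _;
  rewrite dotDr scalerDl.
Qed.

Lemma frame_sumZ us a x : frame_sum us (a *: x) = a *: frame_sum us x.
Proof.
by rewrite /frame_sum scaler_sumr; apply: eq_bigr => u _; rewrite dotZr scalerA.
Qed.

Lemma frame_sumN us x : frame_sum us (- x) = - frame_sum us x.
Proof. by rewrite -scaleN1r frame_sumZ scaleN1r. Qed.

Lemma norm_frame_sum us x : (forall u, u \in us -> `|u| <= 1) ->
  `|frame_sum us x| <= \sum_(u <- us) `|'[u, x]|.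
Proof.
move=> us1; rewrite /frame_sum; apply: le_trans (ler_norm_sum _ _ _) _.
rewrite big_seq [leRHS]big_seq; apply: ler_sum => u /us1 u1.
by rewrite normrZ ler_piMr.
Qed.

Lemma frame_sum_in us x (F : set H) :
    F 0 -> (forall a y z, F y -> F z -> F (a *: y + z)) ->
    (forall u, u \in us -> F u) ->
  F (frame_sum us x).
Proof.
move=> F0 FL; rewrite /frame_sum; elim: us => [|u us IH] Fu;
  first by rewrite big_nil.
rewrite big_cons; apply: FL; first by apply: Fu; rewrite inE eqxx.
by apply: IH => v vu; apply: Fu; rewrite inE vu orbT.
Qed.

(** Gram-Schmidt orthogonalization, stated through the projection rather than
    through orthonormality: [frame_sum us] is self-adjoint ([dot_frame_sum])
    and fixes [e], hence [x - frame_sum us x] is orthogonal to [e]. *)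
Lemma gram_schmidt e : exists us : seq H,
  [/\ forall u, u \in us -> frame_sum us u = u,
      forall u, u \in us -> `|u| <= 1,
      forall v, v \in e -> frame_sum us v = v &
      forall F : set H, F 0 -> (forall a y z, F y -> F z -> F (a *: y + z)) ->
        (forall v, v \in e -> F v) -> forall u, u \in us -> F u].
Proof.
elim: e => [|e0 e [us [us_id us1 use usF]]]; first by exists [::]; split.
pose d := e0 - frame_sum us e0.
have PP x : frame_sum us (frame_sum us x) = frame_sum us x.
  apply: (@frame_sum_in us x [set y | frame_sum us y = y]) => /=.
  - by rewrite -(scale0r 0) frame_sumZ !scale0r.
  - by move=> a y z hy hz; rewrite frame_sumD frame_sumZ hy hz.
  - exact: us_id.
have dperp v : frame_sum us v = v -> '[d, v] = 0.
  by move=> vE; rewrite /d; expand_dot; rewrite dot_frame_sum vE subrr.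
have [d0|d0] := eqVneq d 0.
  exists us; split=> //.
    move=> v; rewrite inE => /predU1P[->|/use//].
    by apply/esym/eqP; rewrite -subr_eq0 -/d d0.
  move=> F F0 FL Fe; apply: usF => // v ve; apply: Fe; by rewrite inE ve orbT.
have nd0 : `|d| != 0 by rewrite normr_eq0.
pose u0 := `|d|^-1 *: d.
have nu0 : `|u0| = 1 by rewrite normrZ normfV normr_id mulVf.
have consE x : frame_sum (u0 :: us) x = '[u0, x] *: u0 + frame_sum us x.
  by rewrite /frame_sum big_cons.
have consid v : frame_sum us v = v -> frame_sum (u0 :: us) v = v.
  by move=> vE; rewrite consE vE dotZl dperp// mulr0 scale0r add0r.
have u0id : frame_sum (u0 :: us) u0 = u0.
  rewrite consE -normsq nu0 expr1n scale1r frame_sumZ /d frame_sumD frame_sumN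
    PP.
  by rewrite subrr scaler0 addr0.
exists (u0 :: us); split.
- by move=> u; rewrite inE => /predU1P[->//|/us_id/consid].
- by move=> u; rewrite inE => /predU1P[->|/us1//]; rewrite nu0.
- move=> v; rewrite inE => /predU1P[->|/use/consid//].
  have -> : e0 = `|d| *: u0 + frame_sum us e0.
    by rewrite scalerA mulfV// scale1r subrK.
  by rewrite frame_sumD frame_sumZ u0id (consid (frame_sum us e0)).
- move=> F F0 FL Fe.
  have usF' := usF F F0 FL.
  have {usF'}Fus u : u \in us -> F u.
    by apply: usF' => v ve; apply: Fe; rewrite inE ve orbT.
  move=> u; rewrite inE => /predU1P[->|/Fus//].
  rewrite -[u0]addr0; apply: (FL) => //.
  rewrite /d addrC -scaleN1r; apply: (FL); first exact: frame_sum_in.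
  by apply: Fe; rewrite inE eqxx.
Qed.

Lemma exists_unit_orthogonal e : infinite_dim_space H ->
  exists w, `|w| = 1 /\ forall v, v \in e -> '[v, w] = 0.
Proof.
move=> Hinf; have [us [_ _ use _]] := gram_schmidt e.
have [y yP] : exists y, frame_sum us y != y.
  apply: contrapT => hn; apply: Hinf.
  exists (size us), (fun i => us`_i); apply/seteqP; split=> // y _.
  exists (fun i => '[us`_i, y]).
  have : frame_sum us y = y.
    by apply/eqP/negPn/negP => yP; apply: hn; exists y.
  by rewrite /frame_sum (big_nth 0) big_mkord => {1}<-.
pose d := y - frame_sum us y.
have nd0 : `|d| != 0 by rewrite normr_eq0 subr_eq0 eq_sym.
exists (`|d|^-1 *: d); split; first by rewrite normrZ normfV normr_id mulVf.
move=> v /use vE; rewrite dotZr /d; expand_dot.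
by rewrite -dot_frame_sum vE subrr mulr0.
Qed.

(** Outside a ball, the norm on [C] is comparable to the largest of finitely
    many continuous linear functionals. This is all that remains of somewhat
    boundedness in the sequel. *)
Definition coercive_on (C : set H) x0 vs c (r : R) : Prop :=
  [/\ forall v, v \in vs -> `|v| <= 1, 0 < c &
      forall x, C x -> r <= `|x - x0| ->
        exists2 v, v \in vs & c * `|x - x0| <= '[v, x - x0]].

(** Let [f] and [o] be the components of [y = x - x0] in [F] and orthogonal to
    [F]. The segment from [y] to the point of [alpha B_F] opposite to [f]
    crosses the orthogonal complement of [F] at [l *: o], where
    [l = alpha / (alpha + |f|)]. So [l *: o] is bounded, and [|o|] grows at
    most linearly in [|f|], which the frame functionals and their opposites
    control. *)
Lemma somewhat_bounded_coercive (C : set H) : somewhat_bounded dot C ->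
  exists x0 vs c (r : R), C x0 /\ coercive_on C x0 vs c r.
Proof.
move=> [_ _ /convex_setP vC [x0 [F [alpha [Cx0 [n [e FE]] alpha0 ballC]]]]].
move=> bF; have [M0 hM0] : exists M0, forall y,
    (orthogonal_complement dot F `&` [set x - x0 | x in C]) y -> `|y| <= M0.
  by move: bF; rewrite /bounded_set => /pinfty_ex_gt0[M _ hM]; exists M.
pose M := Num.max M0 0.
have M_ge0 : 0 <= M by rewrite le_max lexx orbT.
have hM y : orthogonal_complement dot F y -> C (y + x0) -> `|y| <= M.
  move=> yF Cy; apply: (@le_trans _ _ M0); last by rewrite le_max lexx.
  by apply: hM0; split=> //; exists (y + x0) => //; rewrite addrK.
have F0 : F 0.
  rewrite FE; exists (fun=> 0); rewrite big1// => i _; exact: scale0r.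
have FL a y z : F y -> F z -> F (a *: y + z).
  rewrite FE => -[b ->] [b' ->]; exists (fun i => a * b i + b' i).
  rewrite scaler_sumr -big_split /=; apply: eq_bigr => i _.
  by rewrite scalerDl scalerA.
have [us [us_id us1 use usF]] := gram_schmidt [seq e i | i <- enum 'I_n].
have Fe v : v \in [seq e i | i <- enum 'I_n] -> F v.
  move=> /mapP[i _ ->]; rewrite FE; exists (fun j => (j == i)%:R).
  rewrite (bigD1 i)//= eqxx scale1r big1 ?addr0// => j /negPf ->.
  by rewrite scale0r.
have Fus := usF F F0 FL Fe.
have FP y : F y -> frame_sum us y = y.
  rewrite FE => -[b ->]; elim/big_ind : _ => //.
  - by rewrite -(scale0r 0) frame_sumZ !scale0r.
  - by move=> y' z hy hz; rewrite frame_sumD hy hz.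
  - by move=> i _; rewrite frame_sumZ use//; apply/mapP; exists i;
      rewrite ?mem_enum.
pose B := 1 + M / alpha.
have B0 : 0 < B by rewrite ltr_pwDl// divr_ge0// ltW.
have bound y : C (y + x0) -> `|y| <= M + B * `|frame_sum us y|.
  move=> Cy; set f := frame_sum us y; pose o := y - f.
  have Ff : F f by exact: frame_sum_in.
  pose l := alpha / (alpha + `|f|).
  have af : 0 < alpha + `|f| by rewrite ltr_pwDl.
  have l0 : 0 < l by rewrite divr_gt0.
  have l1 : l <= 1 by rewrite ler_pdivrMr// mul1r lerDl.
  pose b := - `|f|^-1 *: f.
  have [z Cz zE] : exists2 z, C z & z - x0 = alpha *: b.
    apply: ballC; exists b => //; split.
      by rewrite -[b]addr0; exact: FL.
    rewrite normrZ normrN normfV normr_id.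
    have [->|f0] := eqVneq `|f| 0; first by rewrite mulr0.
    by rewrite mulVf.
  have : `|l *: o| <= M.
    apply: hM.
      move=> v Fv; rewrite dotZl /o; expand_dot.
      by rewrite dot_frame_sum FP// subrr mulr0.
    have -> : l *: o + x0 = l *: (y + x0) + (1 - l) *: z.
      have -> : z = alpha *: b + x0 by rewrite -zE subrK.
      rewrite !scalerDr addrACA -scalerDl (_ : l + (1 - l) = 1) ?scale1r;
        last by ring.
      congr (_ + _); rewrite scalerN; congr (_ + _).
      rewrite !scalerA; have [f0|f0] := eqVneq f 0;
        first by rewrite f0 !scaler0 oppr0.
      rewrite -scaleNr; congr (_ *: _); rewrite /l; field.
      by rewrite normr_eq0 f0 gt_eqF.
    by apply: vC => //; exact: ltW.
  rewrite normrZ (gtr0_norm l0) mulrAC ler_pdivrMr// => h.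
  have {}h : `|o| <= M + M / alpha * `|f|.
    have -> : M + M / alpha * `|f| = M * (alpha + `|f|) / alpha.
      by field; rewrite gt_eqF.
    by rewrite ler_pdivlMr// mulrC.
  have := ler_normD o f; rewrite subrK /B; lra.
pose N : R := (size us).+1%:R.
have N0 : 0 < N by rewrite ltr0Sn.
pose c := (2 * B * N)^-1.
have c0 : 0 < c by rewrite invr_gt0 !mulr_gt0.
exists x0, (us ++ map -%R us), c, (2 * M + 1); split=> //; split=> //.
  move=> v; rewrite mem_cat => /orP[/us1//|/mapP[u /us1 u1 ->]].
  by rewrite normrN.
move=> x Cx rx; set y := x - x0 in rx *.
have y0 : 0 < `|y| by lra.
have hy : `|y| <= M + B * `|frame_sum us y| by apply: bound; rewrite subrK.
have [u uus hu] : exists2 u, u \in us & c * `|y| <= `|'[u, y]|.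
  apply: contrapT => hn.
  have hlt u : u \in us -> `|'[u, y]| <= c * `|y|.
    move=> uus; rewrite leNgt; apply/negP => h; apply: hn.
    by exists u => //; exact: ltW.
  have hs : \sum_(u <- us) `|'[u, y]| <= (N - 1) * (c * `|y|).
    rewrite big_seq; apply: le_trans (ler_sum _ hlt) _.
    rewrite -big_seq big_const_seq count_predT iter_addr_0.
    by rewrite /N -addn1 natrD addrK mulr_natl.
  have h2 := le_trans (norm_frame_sum y us1) hs.
  have h3 : B * `|frame_sum us y| <= B * ((N - 1) * (c * `|y|)).
    by rewrite ler_pM2l.
  have h4 : B * N * c = 2^-1.
    by rewrite /c; field; rewrite !gt_eqF.
  have h5 : B * ((N - 1) * (c * `|y|)) = 2^-1 * `|y| - B * c * `|y|.
    by rewrite -h4; ring.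
  have h6 : 0 < B * c * `|y| by rewrite !mulr_gt0.
  by clear FE; lra.
have [s|s] := leP 0 '[u, y].
  exists u; first by rewrite mem_cat uus.
  by rewrite (ger0_norm s) in hu.
exists (- u); first by rewrite mem_cat; apply/orP; right; apply: map_f.
by rewrite dotNl -(ltr0_norm s).
Qed.

End finite_frames.

Arguments coercive_on {R H} dot C x0 vs c r.

(** * Perturbing a nonexpansive map *)

Section perturbation.
Context {R : realType} {H : completeNormedModType R}.
Context {dot : {dot H for idfun}} (dot_norm : hilbert_norm dot).

Implicit Types (x y z u v w p q : H) (a b c t : R) (us vs e X Y : seq H).
Implicit Types (C : set H) (f g h : H -> H).

Local Notation "''[' u , v ]" := (dot u v) : ring_scope.

Let normsq := normsq dot_norm.
Let normsqB := normsqB dot_norm.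
Let normsqD := normsqD dot_norm.
Let dot_le := dot_le dot_norm.
Let dot_ge := dot_ge dot_norm.

Definition nonexpansive_on C g :=
  (forall x, C x -> C (g x)) /\
  forall x y, C x -> C y -> `|g x - g y| <= `|x - y|.

(** For each [v] in [vs], [Y] contains the point [y] of [C] nearest to [x0] in
    the half-space [T <= '[v, y - x0]], if [C] meets it. A point [x] of [C] far
    out in the direction [v] then satisfies [(rho + 1) |x - x0| <=
    '[y - x0, x - x0]], by the variational inequality of [y] at the point of
    the segment from [x0] to [x] where [v] has the value [T]. If [x] is also an
    eigenpoint, [|g x - g y|] is at least [|x - x0| - rho], so nonexpansiveness
    forces [2 |x - x0| <= |y - x0|^2]. Only the finitely many values of [g] on
    [Y] are constrained, which makes this a statement about an open set of
    maps. *)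
Lemma localized_eigenpoints C x0 vs c (r0 rho : R) :
    closed C -> convex_set C -> C x0 ->
    coercive_on dot C x0 vs c r0 ->
    0 <= rho ->
  exists Y (r : R), (forall y, y \in Y -> C y) /\
    forall g, nonexpansive_on C g ->
      (forall y, y \in Y -> `|g y - x0| <= rho) ->
      forall x a, C x -> 1 <= a -> g x - x0 = a *: (x - x0) -> `|x - x0| <= r.
Proof.
move=> cC vC C0 [vs1 c0 coer] rho0.
pose T := 1 + (rho + 1) / c.
have T1 : 1 <= T by rewrite lerDl divr_ge0 ?ltW// ltr_wpDl.
have T0 : 0 < T by lra.
have Tc : rho + 1 <= T * c by rewrite /T mulrDl divfK ?gt_eqF// lerDr mul1r ltW.
have /choice[y_ hy] : forall v, exists y, C y /\
    forall x, C x -> T <= '[v, x - x0] ->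
      '[x0 - y, x - y] <= 0 /\ T <= '[v, y - x0].
  move=> v; pose D := C `&` [set x | T + '[v, x0] <= '[v, x]].
  have DE x : (T + '[v, x0] <= '[v, x]) = (T <= '[v, x - x0]).
    by expand_dot; rewrite lerBrDr.
  have [D0|D0] := pselect (D !=set0); last first.
    exists x0; split=> // x Cx Tx; exfalso; apply: D0; exists x; split=> //=.
    by rewrite DE.
  have [|||P [DP hP]] := @metric_projection _ _ _ dot_norm D.
  - by apply: closedI => //; exact: closed_halfspace.
  - by apply: convex_setI => //; exact: convex_halfspace.
  - exact: D0.
  exists (P x0); split; first exact: (DP x0).1.
  move=> x Cx Tx; split; first by apply: hP; split=> //=; rewrite DE.
  by rewrite -DE; exact: (DP x0).2.
pose sq v := `|y_ v - x0| ^+ 2.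
pose r := `|r0| + T / c + rho + \sum_(v <- vs) sq v.
have sq0 v : 0 <= sq v by rewrite exprn_ge0.
have sum0 : 0 <= \sum_(v <- vs) sq v by apply: sumr_ge0.
have Tc0 : 0 <= T / c by rewrite divr_ge0 ?ltW.
exists (map y_ vs), r; split.
  by move=> y /mapP[v _ ->]; exact: (hy v).1.
move=> g [Cg gne] gY x a Cx a1 gx; rewrite leNgt; apply/negP => rx.
have [|v vvs cv] := coer x Cx.
  by apply: le_trans (ltW rx); have := ler_norm r0; rewrite /r; lra.
have sqv : sq v <= \sum_(u <- vs) sq u.
  by rewrite (big_rem v)//= lerDl sumr_ge0.
have [Cy hyx] := hy v.
have gy : `|g (y_ v) - x0| <= rho by apply: gY; exact: map_f.
set xi := x - x0 in rx cv gx; set eta := y_ v - x0.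
pose s := '[v, xi].
have xi0 : 0 < `|xi|.
  by apply: le_lt_trans rx; rewrite /r; have := normr_ge0 r0; lra.
have Ts : T <= s.
  apply: le_trans cv; rewrite -ler_pdivrMl// mulrC.
  by apply: le_trans (ltW rx); rewrite /r; have := normr_ge0 r0; lra.
have s0 : 0 < s by exact: lt_le_trans Ts.
pose t := T / s.
have t0 : 0 < t by rewrite divr_gt0.
have t1 : t <= 1 by rewrite ler_pdivrMr// mul1r.
have x'E : t *: x + (1 - t) *: x0 - x0 = t *: xi.
  by rewrite scalerBl scale1r scalerBr -addrA (addrAC x0) subrr add0r.
have [||h1 h2] := hyx (t *: x + (1 - t) *: x0).
- by move/convex_setP: vC; apply=> //; exact: ltW.
- by rewrite x'E dotZr /t -/s divfK// gt_eqF.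
have {}h1 : `|eta| ^+ 2 <= t * '[eta, xi].
  move: h1; have -> : t *: x + (1 - t) *: x0 - y_ v = t *: xi - eta.
    by rewrite -x'E /eta opprB addrA subrK.
  have -> : x0 - y_ v = - eta by rewrite opprB.
  by rewrite normsq; expand_dot; lra.
have Teta : T <= `|eta|.
  apply: le_trans (le_trans h2 (dot_le _ _)) _.
  by rewrite ler_piMl// vs1.
have h3 : (rho + 1) * `|xi| <= '[eta, xi].
  apply: (@le_trans _ _ (T * s)).
    apply: (@le_trans _ _ (T * c * `|xi|)); first by rewrite ler_pM2r.
    by rewrite -mulrA ler_pM2l.
  have : T ^+ 2 <= t * '[eta, xi].
    by apply: le_trans h1; rewrite ler_pXn2r ?nnegrE// ltW.
  rewrite /t mulrAC ler_pdivlMr// expr2 -mulrA ler_pM2l//.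
have : `|g x - g (y_ v)| <= `|xi - eta|.
  by rewrite opprB addrA subrK; exact: gne.
have -> : g x - g (y_ v) = a *: xi - (g (y_ v) - x0).
  by rewrite -gx opprB addrA subrK.
move=> h4.
have h5 : `|xi| - rho <= `|xi - eta|.
  apply: le_trans h4; have := lerB_dist (a *: xi) (g (y_ v) - x0).
  rewrite normrZ ger0_norm; last lra.
  have : 0 <= (a - 1) * `|xi| by rewrite mulr_ge0// subr_ge0.
  lra.
have xirho : 0 <= `|xi| - rho.
  by rewrite subr_ge0; apply: le_trans (ltW rx); rewrite /r;
    have := normr_ge0 r0; lra.
move: h5; rewrite -(@ler_pXn2r _ 2)// ?nnegrE// normsqB (dotC xi) sqrrB.
have : 0 <= rho ^+ 2 by rewrite exprn_ge0.
rewrite -/(sq v).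
have := normr_ge0 r0; move: sqv rx h3 Tc0 rho0; rewrite /r; lra.
Qed.

Lemma strictly_convex_interior C : strictly_convex C -> C !=set0 ->
    ~ (exists x, C = [set x]) ->
  exists x (r : R), 0 < r /\ forall y, `|y - x| < r -> C y.
Proof.
move=> [cC vC sC] [x Cx] nsing.
have [y Cy yx] : exists2 y, C y & y != x.
  apply: contrapT => hn; apply: nsing; exists x; apply/seteqP; split=> y /=.
    move=> Cy; apply/eqP/negPn/negP => yx; apply: hn; by exists y.
  by move=> ->.
have [z sz Bz] : exists2 z, segment y x z & ~ boundary C z.
  apply: contrapT => hn; apply: (sC _ _ yx) => z sz; apply: contrapT => Bz.
  by apply: hn; exists z.
have Cz : C z.
  case: sz => t _ <-; have := vC y x t; rewrite !inE; exact.
have : interior C z.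
  apply: contrapT => iz; apply: Bz; split=> //; exact: subset_closure.
rewrite /interior /= -nbhs_ballE => -[r /= r0 hr]; exists z, r; split=> // u uz.
by apply: hr; rewrite -ball_normE /ball_ /= distrC.
Qed.

(** If points of [C] in the ball with ['[n, x - p]] tending to 0 stayed away
    from [p] in the direction [d], the nested sets of such points would have a
    common point [q]: [p] and [q] would both maximize ['[n, _]] on [C], and the
    segment between them would lie in the boundary of [C]. *)
Lemma thin_slice C x0 p (n d : H) (r e : R) :
    strictly_convex C -> C p -> n != 0 -> 0 < e ->
    (forall x, C x -> '[n, x - p] <= 0) ->
  exists2 delta : R, 0 < delta &
    forall x, C x -> `|x - x0| <= r -> - delta <= '[n, x - p] -> '[d, x - p] <
      e.
Proof.
move=> [cC vC sC] Cp n0 e0 np; apply: contrapT => hn.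
pose D k := (C `&` [set x | `|x - x0| <= r]) `&`
  ([set x | '[n, p] - k.+1%:R^-1 <= '[n, x]] `&` [set x | '[d, p] + e <= '[d,
    x]]).
have [] := @nested_closed_convex _ _ _ dot_norm D (`|x0| + r).
- move=> k; apply: closedI; apply: closedI => //.
  + exact: closed_normball.
  + exact: closed_halfspace.
  + exact: closed_halfspace.
- move=> k; apply: convex_setI; apply: convex_setI => //.
  + exact: convex_normball.
  + exact: convex_halfspace.
  + exact: convex_halfspace.
- move=> k; apply: contrapT => Dk; apply: hn; exists k.+1%:R^-1.
    by rewrite invr_gt0.
  move=> x Cx xr nx; rewrite ltNge; apply/negP => ex; apply: Dk; exists x.
  move: nx ex; rewrite !dotDr !dotNr => nx ex.
  by split; split=> //=; [move: nx; move: k.+1%:R^-1 => ? ?; lra|lra].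
- move=> k m km x [Cx [nx dx]]; split=> //; split=> //=; apply: le_trans nx.
  by rewrite lerD2l lerN2 lef_pV2 ?posrE// ler_nat.
- move=> x [[_ /= xr] _]; have := ler_normD x0 (x - x0).
  by rewrite addrC subrK; lra.
move=> q hq; have [[Cq _] [_ /= dq]] := hq 0%N.
have nq : '[n, p] <= '[n, q].
  have lim : '[n, p] - k.+1%:R^-1 @[k --> \oo] --> '[n, p] - 0.
    by apply: cvgB; [exact: cvg_cst|exact: cvg_harmonic].
  rewrite subr0 in lim.
  apply: (closed_cvg (fun s : R => s <= '[n, q]) _ _ _ lim).
    exact: closed_le.
  by apply: nearW => k; have [_ []] := hq k.
have pq : p != q by apply/eqP => pq; move: dq; rewrite pq; lra.
apply: (sC p q pq) => y [t _ <-].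
have Cy : C (conv t (p : convex_lmodType H) (q : convex_lmodType H)).
  by have := vC p q t; rewrite !inE; exact.
set y' := conv _ _ _ in Cy *; split; first exact: subset_closure.
move=> iy; have ny : '[n, p] <= '[n, y'].
  have : convex_set ([set x | '[n, p] <= '[n, x]] : set H).
    by exact: convex_halfspace.
  by move=> /(_ p q t); rewrite !inE /=; apply.
clearbody y'; move: iy; rewrite /interior /= -nbhs_ballE => -[s /= s0 hs].
have nn0 : 0 < `|n| by rewrite normr_gt0.
have : C (y' + (s / 2 / `|n|) *: n).
  apply: hs; rewrite -ball_normE /ball_ /= opprD addrA subrr add0r normrN
    normrZ.
  rewrite ger0_norm ?divfK ?gt_eqF//; last by rewrite !divr_ge0// ltW.
  by lra.
move=> /np; rewrite !dotDr dotNr dotZr -normsq.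
have : 0 < s / 2 / `|n| * `|n| ^+ 2.
  by rewrite !mulr_gt0// ?invr_gt0// exprn_gt0.
lra.
Qed.

(** Square [|g z - x| <= |z - x|]. *)
Lemma fixed_point_halfspace C g z x : nonexpansive_on C g -> C z -> C x ->
  g x = x -> 0 <= '[g z - z, x - z].
Proof.
move=> [_ gne] Cz Cx gx; have := gne z x Cz Cx; rewrite gx.
have -> : g z - x = (g z - z) - (x - z) by rewrite opprB addrA subrK.
rewrite (distrC z) -(@ler_pXn2r _ 2)// ?nnegrE// normsqB.
have : 0 <= `|g z - z| ^+ 2 by rewrite exprn_ge0.
by clear gx; lra.
Qed.

(** Let [Q] be the projection onto the hyperplane through [q] orthogonal to
    [w]. By Pythagoras, the map that acts as [Q \o f] on the component [Q x]
    (first projected to [C]) and as the identity along [w] is nonexpansive. It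
    agrees with [f] on [X] and fixes the line [q + t *: w], so a translation,
    small when [y] is near [z] and [z] is near that line, takes its value at
    [z] to [y]. The projection onto [C] turns it into a self-map. *)
Lemma shear_perturbation C f q w X z y t :
    closed C -> convex_set C -> nonexpansive_on C f -> C q -> f q = q ->
    `|w| = 1 -> (forall x, x \in X -> C x) ->
    (forall x, x \in X -> '[x - q, w] = 0 /\ '[f x - q, w] = 0) ->
    C z -> C y ->
  exists h, [/\ nonexpansive_on C h, h z = y &
    forall x, x \in X -> `|h x - f x| <= `|y - z| + 2 * `|z - (q + t *: w)|].
Proof.
move=> cC vC [Cf fne] Cq fq w1 CX Xw Cz Cy.
have ww : '[w, w] = 1 by rewrite -normsq w1 expr1n.
have [|P [CP hP]] := metric_projection dot_norm cC vC; first by exists q.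
have Pne := projection_nonexpansive dot_norm CP hP.
have Pid := projection_id dot_norm hP.
pose Q x := x - '[w, x - q] *: w.
have QB x x' : Q x - Q x' = (x - x') - '[w, x - x'] *: w.
  rewrite /Q opprD addrACA; congr (_ + _); rewrite -opprD -scalerBl;
    congr (- (_ *: _)).
  by expand_dot; ring.
have Qw x x' : '[Q x - Q x', w] = 0.
  by rewrite QB dotDl dotNl dotZl ww mulr1 dotC subrr.
have pyth x x' : `|x - x'| ^+ 2 = `|Q x - Q x'| ^+ 2 + '[w, x - x'] ^+ 2.
  transitivity (`|(Q x - Q x') + '[w, x - x'] *: w| ^+ 2);
    first by rewrite QB subrK.
  rewrite (normsqD (Q x - Q x')) dotZr Qw !mulr0.
  by rewrite addr0 normrZ w1 mulr1 real_normK ?num_real.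
have Qne x x' : `|Q x - Q x'| <= `|x - x'|.
  by rewrite -(@ler_pXn2r _ 2)// ?nnegrE// (pyth x x') lerDl sqr_ge0.
pose F x := Q (f (P (Q x))) + '[w, x - q] *: w.
have Fne x x' : `|F x - F x'| <= `|x - x'|.
  rewrite -(@ler_pXn2r _ 2)// ?nnegrE// (pyth x x').
  have -> : F x - F x' =
      (Q (f (P (Q x))) - Q (f (P (Q x')))) + '[w, x - x'] *: w.
    rewrite /F opprD addrACA; congr (_ + _); rewrite -scalerBl; congr (_ *: _).
    by expand_dot; ring.
  rewrite (normsqD (Q _ - Q _)) dotZr Qw !mulr0 addr0 normrZ w1 mulr1
    real_normK ?num_real//.
  rewrite lerD2r ler_pXn2r ?nnegrE//.
  apply: (le_trans (Qne _ _)); apply: (le_trans (fne _ _ (CP _) (CP _))).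
  exact: Pne.
pose u := y - F z.
have Fq : `|z - F z| <= 2 * `|z - (q + t *: w)|.
  have -> : z - F z = Q z - Q (f (P (Q z))).
    by rewrite /F {2}/Q opprD addrA addrAC.
  have Qt : Q (q + t *: w) = q.
    by rewrite /Q [q + _ - q]addrAC subrr add0r dotZr ww mulr1 addrK.
  have Qq : Q q = q by rewrite /Q subrr dot0r scale0r subr0.
  have h1 : `|Q z - q| <= `|z - (q + t *: w)| by rewrite -{1}Qt.
  have h2 : `|Q (f (P (Q z))) - q| <= `|Q z - q|.
    rewrite -{1}Qq; apply: (le_trans (Qne _ _)).
    rewrite -{1}fq; apply: (le_trans (fne _ _ (CP _) Cq)).
    by rewrite -{1}(Pid q Cq); exact: Pne.
  have := ler_normB (Q z - q) (Q (f (P (Q z))) - q).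
  by rewrite opprB addrA subrK; lra.
exists (fun x => P (F x + u)); split.
- split=> [x _|x x' _ _]; first exact: CP.
  apply: (le_trans (Pne _ _)); rewrite opprD addrACA subrr addr0; exact: Fne.
- by rewrite /u addrC subrK Pid.
- move=> x xX; have [xw fxw] := Xw x xX.
  have Fx : F x = f x.
    have wx : '[w, x - q] = 0 by rewrite dotC.
    have -> : F x = Q (f (P (Q x))) by rewrite /F wx scale0r addr0.
    have -> : Q x = x by rewrite /Q wx scale0r subr0.
    rewrite Pid; last exact: CX.
    by rewrite /Q dotC fxw scale0r subr0.
  rewrite Fx -{2}(Pid (f x)); last by apply: Cf; exact: CX.
  apply: (le_trans (Pne _ _)); rewrite addrAC subrr add0r /u.
  have := ler_normD (y - z) (z - F z); rewrite addrA subrK; lra.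
Qed.

(** Coercivity bounds [C] along [w], since the functionals [vs] are constant in
    that direction. *)
Lemma exit_point C x0 vs c (r0 eta : R) q w :
    coercive_on dot C x0 vs c r0 ->
    C q -> `|w| = 1 -> (forall v, v \in vs -> '[v, w] = 0) -> 0 < eta ->
  exists t, C (q + t *: w) /\ ~ C (q + t *: w + eta *: w).
Proof.
move=> [vs1 c0 coer] Cq w1 vsw eta0; apply: contrapT => hn.
have Call k : C (q + (k%:R * eta) *: w).
  elim: k => [|k IH]; first by rewrite mul0r scale0r addr0.
  apply: contrapT => nC; apply: hn; exists (k%:R * eta); split=> // Ck;
    apply: nC.
  by rewrite -addn1 natrD mulrDl mul1r scalerDl addrA.
pose M := `|q - x0|.
have M0 : 0 <= M by exact: normr_ge0.
have Mc : 0 <= M / c by rewrite divr_ge0// ltW.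
pose B := `|r0| + M / c + M + 1.
have B0 : 0 <= B by rewrite /B; have := normr_ge0 r0; lra.
have [k kB] : exists k : nat, B < k%:R * eta.
  exists (Num.bound (B / eta)); rewrite -ltr_pdivrMr//.
  by apply: archi_boundP; rewrite divr_ge0// ltW.
set x := q + (k%:R * eta) *: w; have Cx : C x by exact: Call.
have xx0 : k%:R * eta - M <= `|x - x0|.
  have -> : x - x0 = (k%:R * eta) *: w + (q - x0) by rewrite /x -addrA addrCA.
  apply: le_trans (lerB_normD _ _); rewrite normrZ w1 mulr1 ger0_norm//.
  by rewrite mulr_ge0// ltW.
have [|v vvs] := coer x Cx.
  by have := ler_norm r0; move: kB; rewrite /B; lra.
have -> : '[v, x - x0] = '[v, q - x0].
  by rewrite /x; expand_dot; rewrite vsw// mulr0 addr0.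
move=> /le_trans/(_ (dot_le _ _)) h.
have : c * `|x - x0| <= M.
  by apply: (le_trans h); rewrite ler_piMl// vs1.
rewrite -ler_pdivlMl// mulrC; have := normr_ge0 r0; move: kB; rewrite /B.
lra.
Qed.

Lemma small_factor (M e : R) : 0 <= M -> 0 < e ->
  exists s : R, [/\ 0 < s, s <= 1 & s * M <= e].
Proof.
move=> M0 e0; have M1 : 0 < M + e by rewrite ltr_wpDl.
exists (e / (M + e)); split; first by rewrite divr_gt0.
  by rewrite ler_pdivrMr// mul1r lerDr.
by rewrite mulrAC ler_pdivrMr// ler_pM2l// lerDl ltW.
Qed.

(** In infinite dimension some unit [w] is orthogonal to all the data, and [C]
    is left at some [p0] when walking from the fixed point [q] along [w]. Near
    [p0] there is a support point [p] of [C] with outer normal [n], and near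
    [p] an interior point [z] with [z + v] in [C], [v] a positive multiple of
    [n]. The shear [h] with [h z = z + v] confines the fixed points of any [g]
    close to [h] at [z] to a slice of [C] at [p], up to a small error; this
    slice is thin in the directions [d] and [- d]. *)
Lemma shrink_fixed_points C x0 vs c (r0 r e e' : R) f q X d :
    infinite_dim_space H -> strictly_convex C -> ~ (exists x, C = [set x]) ->
    coercive_on dot C x0 vs c r0 ->
    nonexpansive_on C f -> C q -> f q = q -> (forall x, x \in X -> C x) ->
    0 < e -> 0 < e' ->
  exists h, [/\ nonexpansive_on C h, forall x, x \in X -> `|h x - f x| < e &
    exists z (delta : R), [/\ C z, 0 < delta &
      forall g, nonexpansive_on C g -> `|g z - h z| < delta ->
      forall x y, C x -> C y -> g x = x -> g y = y ->
        `|x - x0| <= r -> `|y - x0| <= r -> '[d, x - y] <= e']].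
Proof.
move=> Hinf sC nsing coer fne Cq fq CX e0 e'0.
have [cC vC _] := sC; have vC' := vC; move/convex_setP in vC'.
have [|m [rho [rho0 Cm]]] := strictly_convex_interior sC _ nsing;
  first by exists q.
have [w [w1 ew]] := exists_unit_orthogonal dot_norm
  (vs ++ map (fun x => x - q) X ++ map (fun x => f x - q) X) Hinf.
have vsw v : v \in vs -> '[v, w] = 0.
  by move=> vvs; apply: ew; rewrite mem_cat vvs.
have Xw x : x \in X -> '[x - q, w] = 0 /\ '[f x - q, w] = 0.
  move=> xX; split; apply: ew; rewrite !mem_cat; apply/orP; right; apply/orP.
    by left; apply/mapP; exists x.
  by right; apply/mapP; exists x.
(* [h] will move the points of [X] by at most [7 * eta]. *)
pose eta := e / 8.
have eta0 : 0 < eta by rewrite divr_gt0.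
have [t [Cp0 nCb]] := exit_point coer Cq w1 vsw eta0.
set p0 := q + t *: w in Cp0 nCb; set b := p0 + eta *: w in nCb.
have [|P [CP hP]] := metric_projection dot_norm cC vC; first by exists q.
pose p := P b; pose n := b - p.
have Cp : C p by exact: CP.
have n0 : n != 0 by rewrite subr_eq0; apply/eqP => bp; apply: nCb; rewrite bp.
have nn : 0 < `|n| by rewrite normr_gt0.
have np x : C x -> '[n, x - p] <= 0 by exact: hP.
have bp0 : `|b - p0| = eta.
  by rewrite /b addrAC subrr add0r normrZ w1 mulr1 gtr0_norm.
have neta : `|n| <= eta.
  rewrite -bp0 -(@ler_pXn2r _ 2)// ?nnegrE//.
  have -> : b - p0 = n - (p0 - p) by rewrite /n opprB addrA subrK.
  rewrite (normsqB n); have := np _ Cp0.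
  have : 0 <= `|p0 - p| ^+ 2 by rewrite exprn_ge0.
  by lra.
have nE : n = b - p by [].
clearbody n.
have e'2 : 0 < e' / 2 by rewrite divr_gt0.
have [d1 d10 hd1] := thin_slice x0 d r sC Cp n0 e'2 np.
have [d2 d20 hd2] := thin_slice x0 (- d) r sC Cp n0 e'2 np.
pose d0 := Num.min d1 d2.
have d00 : 0 < d0 by rewrite lt_min d10 d20.
(* [z] divides the segment from [p] to the interior point [m] in the ratio [s];
   [s] is so small that [z] is near [p] and the slice at [z] has small depth. *)
pose M := `|m - p| + `|n| * `|m - p| + rho.
have [|| s [s0 s1 sM]] := @small_factor M (Num.min eta (d0 / 2)).
- by rewrite !addr_ge0// ?mulr_ge0// ltW.
- by rewrite lt_min eta0 divr_gt0.
have [sp snp srho] : [/\ s * `|m - p| <= eta, s * (`|n| * `|m - p|) <= d0 / 2 &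
    s * rho <= eta].
  move: sM; rewrite le_min /M !mulrDr => /andP[h1 h2].
  have : 0 <= s * `|m - p| by rewrite mulr_ge0// ltW.
  have : 0 <= s * (`|n| * `|m - p|) by rewrite !mulr_ge0// ltW.
  have : 0 <= s * rho by rewrite mulr_ge0// ltW.
  by move=> *; split; lra.
pose z := s *: m + (1 - s) *: p.
have zp : z - p = s *: (m - p).
  by rewrite /z scalerBl scale1r scalerBr -addrA (addrAC p) subrr add0r.
pose k := rho / 2 / `|n|.
have k0 : 0 < k by rewrite !divr_gt0.
have kn : `|k *: n| = rho / 2.
  by rewrite normrZ gtr0_norm// divfK// gt_eqF.
pose v := (s * k) *: n.
have nv : `|v| <= eta.
  have -> : v = s *: (k *: n) by rewrite scalerA.
  rewrite normrZ kn gtr0_norm//; have : 0 <= s * rho by rewrite mulr_ge0// ltW.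
  lra.
have Cball y : `|y - m| < rho -> C (s *: y + (1 - s) *: p).
  by move=> ym; apply: vC' => //; [exact: ltW|exact: Cm].
have Cz : C z by apply: Cball; rewrite subrr normr0.
have Czv : C (z + v).
  have -> : z + v = s *: (m + k *: n) + (1 - s) *: p.
    by rewrite /z /v scalerDr scalerA addrAC.
  by apply: Cball; rewrite addrAC subrr add0r kn; lra.
clearbody z.
have [h [hne hz hX]] := shear_perturbation t cC vC fne Cq fq w1 CX Xw Cz Czv.
exists h; split=> //.
  move=> x xX; apply: (le_lt_trans (hX x xX)).
  rewrite [z + v - z]addrAC subrr add0r -/p0.
  have : `|z - p0| <= 3 * eta.
    have -> : z - p0 = (z - p) - (b - p) + (b - p0).
      by rewrite opprB !subrKA.
    have := ler_normD ((z - p) - (b - p)) (b - p0).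
    have := ler_normB (z - p) (b - p); rewrite bp0 -nE.
    have : `|z - p| <= eta by rewrite zp normrZ gtr0_norm.
    by lra.
  by rewrite /eta in nv *; lra.
pose K := `|r| + `|x0 - z| + 1.
have K0 : 0 < K by rewrite ltr_wpDl// addr_ge0.
exists z, (s * k * (d0 / 2) / K); split=> //.
  by rewrite !divr_gt0// !mulr_gt0// invr_gt0.
move=> g gne; rewrite hz => gz.
have slice x : C x -> g x = x -> `|x - x0| <= r -> - d0 <= '[n, x - p].
  move=> Cx gx xr; have := fixed_point_halfspace gne Cz Cx gx.
  have -> : g z - z = (g z - (z + v)) + v by rewrite opprD addrA subrK.
  rewrite dotDl => h1.
  have xz : `|x - z| <= K.
    have := ler_normD (x - x0) (x0 - z); rewrite addrA subrK.
    by have := ler_norm r; rewrite /K; lra.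
  have h2 : '[g z - (z + v), x - z] <= s * k * (d0 / 2).
    apply: (le_trans (dot_le _ _)).
    rewrite -[leRHS](@divfK _ K) ?gt_eqF//.
    by apply: ler_pM => //; exact: ltW.
  have {h1 h2} : 0 <= s * k * (d0 / 2 + '[n, x - z]).
    by move: h1 h2; rewrite dotZl; lra.
  rewrite (pmulr_rge0 _ (mulr_gt0 s0 k0)) => h1.
  have -> : x - p = (x - z) + (z - p) by rewrite addrA subrK.
  rewrite dotDr zp dotZr.
  have := dot_ge n (m - p); rewrite -(ler_pM2l s0); lra.
move=> x y Cx Cy gx gy xr yr.
have dd1 : - d1 <= - d0 by rewrite lerN2 ge_min lexx.
have dd2 : - d2 <= - d0 by rewrite lerN2 ge_min lexx orbT.
have := hd1 x Cx xr (le_trans dd1 (slice x Cx gx xr)).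
have := hd2 y Cy yr (le_trans dd2 (slice y Cy gy yr)).
by expand_dot; lra.
Qed.

End perturbation.

(** * The topology of pointwise convergence *)

Section pointwise_topology.
Context {R : realType} {H : completeNormedModType R} {C : set H}.

Lemma open_nonexpansive_finite (O : set (nonexpansive_maps C))
    (f : nonexpansive_maps C) :
  open O -> O f ->
  exists (X : seq C) (e : R), 0 < e /\
    forall g : nonexpansive_maps C,
      (forall x, x \in X ->
         `|set_val (set_val g x) - set_val (set_val f x)| < e) -> O g.
Proof.
move=> [V oV <-] Of.
(* The filter of the basic neighbourhoods converges to [f] coordinatewise. *)
pose F : set_system {ptws C -> C} :=
  [set S | exists (X : seq C) (e : R), 0 < e /\
    forall g : {ptws C -> C},
      (forall x, x \in X ->
         `|set_val (g x) - set_val (set_val f x)| < e) -> S g].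
have Ffilter : Filter F.
  split.
  - by exists [::], 1; split.
  - move=> S1 S2 [X1 [e1 [e10 h1]]] [X2 [e2 [e20 h2]]].
    exists (X1 ++ X2), (Num.min e1 e2); split; first by rewrite lt_min e10 e20.
    move=> g gX; split.
      apply: h1 => x xX; have := gX x; rewrite mem_cat xX => /(_ erefl).
      by rewrite lt_min => /andP[].
    apply: h2 => x xX; have := gX x; rewrite mem_cat xX orbT => /(_ erefl).
    by rewrite lt_min => /andP[].
  - move=> S1 S2 S12 [X [e [e0 h]]]; exists X, e; split=> // g gX.
    exact/S12/h.
have : F --> (set_val f : {ptws C -> C}).
  apply/cvg_sup => i A /=.
  move=> [B [[B' oB' BE] Bf] BA].
  case: oB' => B'' oB'' B''E.
  have : nbhs (set_val (set_val f i)) B''.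
    apply: open_nbhs_nbhs; split => //.
    by move: Bf; rewrite -BE -B''E.
  rewrite -nbhs_ballE => -[e /= e0 eB].
  exists [:: i], e; split=> // g /(_ i); rewrite inE eqxx => /(_ erefl) gi.
  apply: BA; rewrite -BE /= -B''E /=; apply: eB.
  by rewrite -ball_normE /ball_ /= distrC.
move=> /(_ V) [|X [e [e0 h]]].
  by apply: open_nbhs_nbhs; split.
by exists X, e; split => // g gX; apply: h.
Qed.

Lemma open_nonexpansive_ball (z : C) (w : H) (e : R) :
  open [set g : nonexpansive_maps C | `|set_val (set_val g z) - w| < e].
Proof.
have -> : [set g : nonexpansive_maps C | `|set_val (set_val g z) - w| < e] =
  (fun g : nonexpansive_maps C => set_val (set_val g z) : H) @^-1` (ball w e).
  by apply/seteqP; split=> g /=; rewrite -ball_normE /ball_ /= distrC.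
apply: open_comp; last exact: ball_open.
move=> g _.
apply: (@continuous_comp _ _ _
    (fun g : nonexpansive_maps C => set_val g z) set_val).
  apply: (@continuous_comp _ _ _ (fun g : nonexpansive_maps C => set_val g)
   (fun h : {ptws C -> C} => h z)).
    exact: initial_continuous.
  exact: proj_continuous.
exact: initial_continuous.
Qed.
End pointwise_topology.

(** * Generic fixed points *)

Section nowhere_dense.
Context {T : topologicalType}.

Lemma nowhere_denseP (A : set T) :
  (forall O : set T, open O -> O !=set0 ->
     exists U : set T, [/\ open U, U !=set0, U `<=` O & U `&` A = set0]) ->
  nowhere_dense A.
Proof.
move=> h; apply/seteqP; split=> // f If; exfalso.
have [|U [oU [g Ug] UO UA]] := h _ (open_interior (closure A)).
  by exists f.
have /interior_subset clg := UO _ Ug.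
have [g' [Ag' Ug']] := clg U (open_nbhs_nbhs (conj oU Ug)).
by have : (U `&` A) g' by []; rewrite UA.
Qed.

End nowhere_dense.

Section generic_fixed_points.
Context {R : realType} {H : completeNormedModType R}.
Context {dot : {dot H for idfun}} (dot_norm : hilbert_norm dot).
Context {C : set H}.

Local Notation "''[' u , v ]" := (dot u v) : ring_scope.
Local Notation NC := (nonexpansive_maps C).

(** The analysis above is about functions on [H] that preserve [C]; the value
    outside [C] does not matter. *)
Definition extend (f : NC) (x : H) : H :=
  if pselect (C x) is left Cx then set_val (set_val f (exist _ x (mem_set Cx)))
  else x.

Lemma extendE (f : NC) (x : C) : extend f (set_val x) = set_val (set_val f x).
Proof.
rewrite /extend; case: pselect => [Cx|]; last by case; exact: set_valP.
by congr (set_val (set_val f _)); apply: val_inj.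
Qed.

Lemma extend_nonexpansive (f : NC) : nonexpansive_on C (extend f).
Proof.
have E x (Cx : C x) : x = set_val (exist _ x (mem_set Cx) : C) by [].
split=> [x Cx|x y Cx Cy].
  by rewrite (E x Cx) extendE; exact: set_valP.
rewrite (E x Cx) (E y Cy) !extendE.
have := set_valP f; exact.
Qed.

Lemma restrict_nonexpansive (h : H -> H) : nonexpansive_on C h ->
  exists f : NC, forall x, C x -> extend f x = h x.
Proof.
move=> [Ch hne].
pose g : {ptws C -> C} :=
  fun x : C => exist _ (h (set_val x)) (mem_set (Ch _ (set_valP x))).
have gN : nonexpansive_maps C g.
  by move=> x y; apply: hne; exact: set_valP.
exists (exist _ g (mem_set gN)) => x Cx.
have -> : x = set_val (exist _ x (mem_set Cx) : C) by [].
by rewrite extendE.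
Qed.

Lemma open_extend_ball (Y : seq H) (h : H -> H) (e : R) :
  (forall y, y \in Y -> C y) ->
  open [set g : NC | forall y, y \in Y -> `|extend g y - h y| < e].
Proof.
elim: Y => [|y Y IH] CY.
  rewrite (_ : [set _ | _] = setT); first exact: openT.
  by apply/seteqP; split.
have Cy : C y by apply: CY; rewrite inE eqxx.
have -> : [set g : NC | forall y', y' \in y :: Y -> `|extend g y' - h y'| < e]
  = [set g : NC | `|set_val (set_val g (exist _ y (mem_set Cy))) - h y| < e] `&`
    [set g : NC | forall y, y \in Y -> `|extend g y - h y| < e].
  have yE (g : NC) : extend g y = set_val (set_val g (exist _ y (mem_set Cy))).
    by rewrite -extendE.
  apply/seteqP; split=> g /=.
    move=> gY; split; first by rewrite -yE; apply: gY; rewrite inE eqxx.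
    by move=> y' y'Y; apply: gY; rewrite inE y'Y orbT.
  move=> [gy gY] y'; rewrite inE => /predU1P[->|/gY//].
  by rewrite yE.
apply: openI; first exact: open_nonexpansive_ball.
by apply: IH => y' y'Y; apply: CY; rewrite inE y'Y orbT.
Qed.

Lemma open_extend_finite (O : set NC) (f : NC) : open O -> O f ->
  exists (X : seq H) (e : R), [/\ 0 < e, forall x, x \in X -> C x &
    forall g : NC, (forall x, x \in X -> `|extend g x - extend f x| < e) -> O
      g].
Proof.
move=> oO Of; have [X [e [e0 hX]]] := open_nonexpansive_finite oO Of.
exists [seq set_val x | x <- X], e; split=> //.
  by move=> x /mapP[y _ ->]; exact: set_valP.
move=> g gX; apply: hX => x xX; rewrite -!extendE; apply: gX; exact: map_f.
Qed.

(** Composing [f] with the projection onto the part of [C] in a large ball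
    changes no value at the finitely many given points and makes the range
    bounded, so that [localized_eigenpoints] applies to all maps near the
    composition: eigenvalues above 1 yield existence of a fixed point, and
    eigenvalue 1 yields a common bound for the fixed points. *)
Lemma generic_localization x0 (vs : seq H) (c r0 : R) :
    closed C -> convex_set C -> C x0 ->
    coercive_on dot C x0 vs c r0 ->
  forall O : set NC, open O -> O !=set0 ->
  exists (U : set NC) (r : R), [/\ open U, U !=set0, U `<=` O &
    forall g, U g -> (exists2 x, C x & extend g x = x) /\
      forall x, C x -> extend g x = x -> `|x - x0| <= r].
Proof.
move=> cC vC C0 coer O oO [f Of].
have [X [e [e0 CX hX]]] := open_extend_finite oO Of.
pose n := \sum_(x <- X) `|extend f x - x0|.
have n0 : 0 <= n by apply: sumr_ge0.
have Xn x : x \in X -> `|extend f x - x0| <= n.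
  by move=> xX; rewrite /n (big_rem x)//= lerDl sumr_ge0.
have [fC fne] := extend_nonexpansive f.
pose K := C `&` [set x | `|x - x0| <= n].
have [|||P [KP hP]] := @metric_projection _ _ _ dot_norm K.
- by apply: closedI => //; exact: closed_normball.
- by apply: convex_setI => //; exact: convex_normball.
- by exists x0; split=> //=; rewrite subrr normr0.
have [|h hE] := @restrict_nonexpansive (fun x => P (extend f x)).
  split=> [x _|x y Cx Cy]; first exact: (KP _).1.
  exact: le_trans (projection_nonexpansive dot_norm KP hP _ _) (fne _ _ Cx Cy).
have hf x : x \in X -> extend h x = extend f x.
  move=> xX; rewrite hE; last exact: CX.
  apply: (projection_id dot_norm hP); split; last exact: Xn.
  by apply: fC; exact: CX.
have n1 : 0 <= n + 1 by rewrite addr_ge0.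
have [Y [r [CY hY]]] := localized_eigenpoints dot_norm cC vC C0 coer n1.
exists (O `&` [set g : NC | forall y, y \in Y -> `|extend g y - extend h y| <
  1]), r.
split.
- by apply: openI => //; exact: open_extend_ball.
- exists h; split; last by move=> y _; rewrite subrr normr0.
  by apply: hX => x xX; rewrite hf// subrr normr0.
- by move=> g [].
move=> g [_ gY]; have gne := extend_nonexpansive g.
have {hY}hY := hY _ gne.
have {}hY : forall x a, C x -> 1 <= a ->
    extend g x - x0 = a *: (x - x0) -> `|x - x0| <= r.
  apply: hY => y yY; have := gY y yY.
  have : `|extend h y - x0| <= n by rewrite hE; [exact: (KP _).2|exact: CY].
  have := ler_normD (extend g y - extend h y) (extend h y - x0).
  by rewrite subrKA => ? ? ?; lra.
split.
  apply: (nonexpansive_fixed_point dot_norm cC vC C0 gne.1 gne.2 (r := r)).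
  by move=> x a Cx a1; apply: hY => //; exact: ltW.
by move=> x Cx gx; apply: (hY x 1) => //; rewrite gx scale1r.
Qed.

(** Localization provides both the fixed point around which
    [shrink_fixed_points] perturbs and the bound that confines the fixed points
    of nearby maps. *)
Lemma generic_thin x0 (vs : seq H) (c r0 : R) (d : H) :
    infinite_dim_space H -> strictly_convex C -> ~ (exists x, C = [set x]) ->
    C x0 ->
    coercive_on dot C x0 vs c r0 ->
  forall O : set NC, open O -> O !=set0 ->
  exists (U : set NC), [/\ open U, U !=set0, U `<=` O &
    forall g, U g -> forall x y, C x -> C y -> extend g x = x ->
      extend g y = y -> '[d, x - y] <= 1].
Proof.
move=> Hinf sC nsing C0 coer O oO On0; have [cC vC _] := sC.
have [V [r [oV [f Vf] VO hV]]] :=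
  generic_localization cC vC C0 coer oO On0.
have [[q Cq fq] _] := hV _ Vf.
have [X [e [e0 CX hX]]] := open_extend_finite oV Vf.
have [h [hne hXf [z [delta [Cz delta0 hz]]]]] := shrink_fixed_points dot_norm
  r d
  Hinf sC nsing coer (extend_nonexpansive f) Cq fq CX e0 ltr01.
have [h' h'E] := restrict_nonexpansive hne.
exists (V `&` [set g : NC | forall y, y \in [:: z] -> `|extend g y - h y| <
  delta]).
split.
- by apply: openI => //; apply: open_extend_ball => y; rewrite inE => /eqP ->.
- exists h'; split.
    apply: hX => x xX; rewrite h'E; first exact: hXf.
    exact: CX.
  by move=> y; rewrite inE => /eqP ->; rewrite h'E// subrr normr0.
- by move=> g [/VO].
move=> g [Vg gz] x y Cx Cy gx gy.
have [_ gr] := hV _ Vg.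
apply: (hz (extend g)) => //.
- exact: extend_nonexpansive.
- by apply: gz; rewrite inE.
- exact: gr.
- exact: gr.
Qed.

End generic_fixed_points.

(** The vectors of a dense set take arbitrarily large values at a nonzero [x],
    so a single bound for all of them suffices. *)
Lemma separates_points (R : realType) (H : completeNormedModType R)
    (dot : {dot H for idfun}) (dot_norm : hilbert_norm dot) (S : set H) (x :
      H) :
  dense S -> (forall s, S s -> dot s x <= 1) -> x = 0.
Proof.
move=> dS Sx; apply/eqP; apply: contrapT => /negP x0.
have nx : 0 < `|x| by rewrite normr_gt0.
pose k := 3 / `|x| ^+ 2.
have [||s [/= sB Ss]] := dS (ball (k *: x) (`|x|^-1)).
  - by exists (k *: x); apply: ballxx; rewrite invr_gt0.
  - by apply: ball_open; rewrite invr_gt0.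
move: sB; rewrite -ball_normE /ball_ /= => sB.
have := Sx _ Ss.
have -> : s = k *: x - (k *: x - s) by rewrite opprB addrC subrK.
rewrite dotDl dotNl dotZl -(normsq dot_norm).
rewrite /k divfK; last by rewrite gt_eqF// exprn_gt0.
have := dot_le dot_norm (k *: x - s) x.
have : `|k *: x - s| * `|x| < 1 by rewrite -ltr_pdivlMr// div1r.
rewrite -/k; lra.
Qed.

Theorem corollary3p7 (R : realType) (H : completeNormedModType R)
    (dot : {dot H for idfun}) (C : set H)
    (dot_norm : hilbert_norm dot)
    (H_separable : separable_space H)
    (H_infinite_dim : infinite_dim_space H)
    (C_closed : closed C)
    (C_strictly_convex : strictly_convex C)
    (C_somewhat_bounded : somewhat_bounded dot C) :
  exists Rs : set (nonexpansive_maps C),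
    residual Rs /\
    forall f : nonexpansive_maps C, Rs f ->
      exists! x : C, set_val f x = x.
Proof.
have [x0 [vs [c [r0 [C0 coer]]]]] :=
  somewhat_bounded_coercive dot_norm C_somewhat_bounded.
have [_ nsing vC _] := C_somewhat_bounded.
have [S /countable_injP[code codeI] dS] := H_separable.
(* [s] enumerates the dense set [S], through the injection [code] into [nat]. *)
pose s n : H := xget 0 [set x | S x /\ code x = n].
pose F n : set (nonexpansive_maps C) :=
  if n is k.+1 then
    [set f | exists x y, [/\ C x, C y, extend f x = x, extend f y = y &
                             ~ (dot (s k) (x - y) <= 1)]]
  else [set f | ~ exists2 x, C x & extend f x = x].
exists (~` \bigcup_n F n); split.
  rewrite /residual setCK; exists F => // -[|k];
    apply: nowhere_denseP => O oO On0.
    have [U [r [oU Un0 UO hU]]] :=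
      generic_localization dot_norm C_closed vC C0 coer oO On0.
    exists U; split=> //; apply/seteqP; split=> // f [/hU[fx _]]; exact.
  have [U [oU Un0 UO hU]] := generic_thin dot_norm (s k) H_infinite_dim
    C_strictly_convex nsing C0 coer oO On0.
  exists U; split=> //; apply/seteqP; split=> // f [/hU hf].
  by move=> [x [y [Cx Cy fx fy]]]; apply; exact: hf.
move=> f Rf.
have [x Cx fx] : exists2 x, C x & extend f x = x.
  by apply: contrapT => hn; apply: Rf; exists 0%N.
pose x' : C := exist _ x (mem_set Cx).
exists x'; split.
  by apply: val_inj; exact: etrans (esym (extendE f x')) fx.
move=> y fy; apply: val_inj => /=; apply/eqP; rewrite -subr_eq0; apply/eqP.
apply: (separates_points dot_norm dS) => t St.
have st : s (code t) = t.
  have [Ss cs] := xgetPex 0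
    (ex_intro (fun x => S x /\ code x = code t) t (conj St erefl)).
  by apply: codeI => //; rewrite inE.
apply: contrapT => ht; apply: Rf; exists (code t).+1 => //.
exists x, (set_val y); split=> //; last by rewrite st.
  exact: set_valP.
by rewrite extendE fy.
Qed.
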